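(* Let $n\ge 1$. For $g\in O(n)$ let $T_g f(x)=f(gx)$, $f\in L^2(\mathbb{R}^n)$. For $m\in\mathbb{N}$ let $\Pi_{n+2m}$ be the orthogonal projection on $L^2(\mathbb{R}^n)$ given by $\Pi_{n+2m}f=\sum_{|\alpha|=m}\langle f,h_\alpha\rangle h_\alpha$, where $h_\alpha$, $\alpha\in\mathbb{N}^n$, are the multi-dimensional Hermite functions. Then $$\Pi_{n+2m}\circ T_g=T_g\circ\Pi_{n+2m},\qquad m\in\mathbb{N},\quad g\in O(n).$$
   Context: $\mathbb{N}=\{0,1,2,\ldots\}$; $O(n)$ is the group of orthogonal transformations of $\mathbb{R}^n$; $L^2(\mathbb{R}^n)$ is taken with respect to Lebesgue measure, with inner product $\langle f,g\rangle=\int_{\mathbb{R}^n} f\overline{g}\,dx$. For $k\in\mathbb{N}$, $h_k(t)=(2^k k!\sqrt{\pi})^{-1/2}H_k(t)e^{-t^2/2}$, $t\in\mathbb{R}$, where $H_k$ is the (physicists') Hermite polynomial of degree $k$. For $\alpha=(\alpha_1,\ldots,\alpha_n)\in\mathbb{N}^n$, $|\alpha|=\alpha_1+\cdots+\alpha_n$ and $h_\alpha(x)=\prod_{i=1}^n h_{\alpha_i}(x_i)$. The $h_\alpha$ form an orthonormal basis of $L^2(\mathbb{R}^n)$ and satisfy $(-\Delta+|x|^2)h_\alpha=(n+2|\alpha|)h_\alpha$. *)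

(* Defs.v *)
From HB Require Import structures.
From mathcomp Require Import all_boot all_order all_algebra.
From mathcomp Require Import complex.
From mathcomp Require Import ring.
From mathcomp Require Import all_classical all_reals all_analysis.

Set Implicit Arguments.
Unset Strict Implicit.
Unset Printing Implicit Defensive.

Import Order.TTheory GRing.Theory Num.Theory.
Import numFieldNormedType.Exports.

Local Open Scope classical_set_scope.
Local Open Scope ring_scope.
Local Open Scope complex_scope.

(* Points of R^n are tuples, because [n.-tuple T] is where the library puts
   the product sigma-algebra. *)
Notation Rn R n := (n.-tuple (measurableTypeR R)).

Section lebesgue_measure_n.
Context {R : realType}.
Local Open Scope ereal_scope.

Definition tuple_cons n (p : measurableTypeR R * Rn R n) : Rn R n.+1 :=
  [tuple of p.1 :: p.2].

Lemma measurable_tuple_cons n :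
  measurable_fun [set: measurableTypeR R * Rn R n] (@tuple_cons n).
Proof. by apply: measurable_cons. Qed.

Section cons.
Variables (n : nat) (mu : {sigma_finite_measure set (Rn R n) -> \bar R}).

Definition lebesgue_cons : set (Rn R n.+1) -> \bar R :=
  pushforward (lebesgue_measure \x mu) (@tuple_cons n).

Let lebesgue_cons0 : lebesgue_cons set0 = 0.
Proof. by rewrite /lebesgue_cons /pushforward preimage_set0 measure0. Qed.

Let lebesgue_cons_ge0 A : 0 <= lebesgue_cons A.
Proof. by rewrite /lebesgue_cons /pushforward measure_ge0. Qed.

Let lebesgue_cons_sigma_additive : semi_sigma_additive lebesgue_cons.
Proof.
have mpre A : measurable A -> measurable (@tuple_cons n @^-1` A).
  by move=> mA; rewrite -[X in measurable X]setTI; exact: measurable_tuple_cons.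
move=> F mF tF mUF; rewrite /lebesgue_cons /pushforward preimage_bigcup.
apply: measure_semi_sigma_additive.
- by move=> i; exact: mpre.
- apply/trivIsetP => i j _ _ ij; rewrite -preimage_setI.
  by move/trivIsetP : tF => /(_ _ _ _ _ ij) ->//; rewrite preimage_set0.
- by rewrite -preimage_bigcup; exact: mpre.
Qed.

HB.instance Definition _ := isMeasure.Build _ _ _ lebesgue_cons
  lebesgue_cons0 lebesgue_cons_ge0 lebesgue_cons_sigma_additive.

Let lebesgue_cons_sigma_finite : sigma_finite setT lebesgue_cons.
Proof.
pose uncons (x : Rn R n.+1) : measurableTypeR R * Rn R n :=
  (thead x, [tuple of behead x]).
have consK : cancel (@tuple_cons n) uncons.
  move=> [a t]; rewrite /uncons /tuple_cons /= theadE; congr pair.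
  exact/val_inj.
have unconsK : cancel uncons (@tuple_cons n).
  by move=> x; rewrite /tuple_cons /= -tuple_eta.
have muncons : measurable_fun setT uncons.
  apply: measurable_fun_pair; last exact: measurable_behead.
  exact: measurable_tnth.
have /sigma_finiteP[F [FT ndF Foo]] := sigma_finiteT (@lebesgue_measure R).
have /sigma_finiteP[G [GT ndG Goo]] := sigma_finiteT mu.
exists (fun k => uncons @^-1` (F k `*` G k)).
  apply/esym; rewrite -preimage_bigcup -[RHS](preimage_setT uncons).
  congr preimage; apply/seteqP; split => // -[x y] _.
  have [i _ Fix] : (\bigcup_i F i) x by rewrite -FT.
  have [j _ Gjy] : (\bigcup_i G i) y by rewrite -GT.
  exists (maxn i j) => //; split => /=.
  - by move: x Fix; exact/subsetPset/ndF/leq_maxl.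
  - by move: y Gjy; exact/subsetPset/ndG/leq_maxr.
move=> k; have [mFk Fkoo] := Foo k; have [mGk Gkoo] := Goo k; split.
  by rewrite -[X in measurable X]setTI; apply: muncons => //; exact: measurableX.
rewrite /lebesgue_cons /pushforward -comp_preimage.
rewrite (_ : uncons \o _ = id) ?preimage_id; last exact/funext.
by rewrite product_measure1E// lte_mul_pinfty// ge0_fin_numE.
Qed.

HB.instance Definition _ := Measure_isSigmaFinite.Build _ _ _ lebesgue_cons
  lebesgue_cons_sigma_finite.

End cons.

Fixpoint lebesgue_measure_n n : {sigma_finite_measure set (Rn R n) -> \bar R} :=
  if n is n'.+1 then lebesgue_cons (lebesgue_measure_n n')
  else \d_([tuple] : Rn R 0).

Lemma lebesgue_measure_n_box n (A : 'I_n -> set (measurableTypeR R)) :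
  (forall i, measurable (A i)) ->
  lebesgue_measure_n n [set x | forall i, A i (tnth x i)] =
  \prod_(i < n) lebesgue_measure (A i).
Proof.
elim: n A => [|n IH] A mA /=.
  rewrite big_ord0 diracE mem_set// => -[] //.
have mB : measurable [set x : Rn R n | forall i, A (lift ord0 i) (tnth x i)].
  rewrite (_ : mkset _ = \bigcap_(i in [set: 'I_n])
      ((fun x : Rn R n => tnth x i) @^-1` A (lift ord0 i))); last first.
    by apply/seteqP; split => [x h i _|x h i]; [exact: h|exact: (h i I)].
  apply: fin_bigcap_measurable => // i _.
  by rewrite -[X in measurable X]setTI; exact: measurable_tnth.
rewrite big_ord_recl -IH// -product_measure1E// /lebesgue_cons /pushforward.
congr product_measure1; apply/seteqP; split => -[a t] /= h.
  split; first by have := h ord0.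
  by move=> i; have := h (lift ord0 i); rewrite tnthS.
move=> i; case: (unliftP ord0 i) => [j|] ->; last by rewrite tnth0; case: h.
by rewrite tnthS; case: h.
Qed.

End lebesgue_measure_n.

Section complex_L2.
Context {R : realType} {n : nat}.
Implicit Types f g : Rn R n -> R[i].

Definition cintegral f : R[i] :=
  (\int[lebesgue_measure_n n]_x complex.Re (f x))%R +i*
  (\int[lebesgue_measure_n n]_x complex.Im (f x))%R.

Definition inner f g : R[i] := cintegral (fun x => f x * (g x)^*).

(* Representatives of the elements of the complex Hilbert space L^2(R^n);
   two of them are the same element when they are equal almost everywhere. *)
Definition L2 : set (Rn R n -> R[i]) := [set f : Rn R n -> R[i] |
  [/\ measurable_fun setT (fun x => complex.Re (f x)),
      measurable_fun setT (fun x => complex.Im (f x)) &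
      (\int[lebesgue_measure_n n]_x ((Normc.normc (f x)) ^+ 2)%:E < +oo)%E]].

End complex_L2.

Section hermite.
Context {R : realType}.

(* The physicists' normalization; Rodrigues' formula is proved just below. *)
Fixpoint hermite_poly (k : nat) : {poly R} :=
  if k is k'.+1 then 2 *: 'X * hermite_poly k' - (hermite_poly k')^`() else 1.

Lemma hermite_poly_Rodrigues (k : nat) (t : R) :
  (hermite_poly k).[t] =
  (-1) ^+ k * expR (t ^+ 2) * derive1n k (fun u : R => expR (- u ^+ 2)) t.
Proof.
have -> : derive1n k (fun u : R => expR (- u ^+ 2)) =
    (fun u => (-1) ^+ k * (hermite_poly k).[u] * expR (- u ^+ 2)).
  elim: k => [|k IH]; first by apply/funext => u /=; rewrite hornerC !mul1r.
  rewrite derive1nS IH; apply/funext => u.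
  rewrite derive1E.
  have dE : is_derive u 1 (fun u : R => expR (- u ^+ 2))
      (- (2 * u) * expR (- u ^+ 2)).
    have dN : is_derive u 1 (fun u : R => - u ^+ 2) (- (2 * u)).
      apply: is_derive_eq.
      by rewrite /GRing.scale /= mulr1 mulr2n mulrDl mul1r.
    have := @is_derive1_comp _ expR (fun u : R => - u ^+ 2) _ _ _
      (is_derive_expR (- u ^+ 2)) dN.
    by rewrite mulrC.
  have dP : is_derive u 1 (fun u => (hermite_poly k).[u])
      (hermite_poly k)^`().[u] by exact: is_derive_poly.
  have dM := is_deriveM (is_deriveZ ((-1) ^+ k) dP) dE.
  have -> : (fun u => (-1) ^+ k * (hermite_poly k).[u] * expR (- u ^+ 2)) =
    ((-1) ^+ k \*: (fun u => (hermite_poly k).[u])) *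
    (fun u : R => expR (- u ^+ 2)) by [].
  rewrite derive_val /= !hornerE /GRing.scale /= [(-1) ^+ k.+1]exprS; ring.
by rewrite mulrACA -expRD subrr expR0 mulr1 mulrA -expr2 sqrr_sign mul1r.
Qed.

Definition hermite_fun1 (k : nat) (t : R) : R :=
  (Num.sqrt (2 ^+ k * k`!%:R * Num.sqrt pi))^-1 *
  (hermite_poly k).[t] * expR (- (t ^+ 2 / 2)).

Definition hermite_fun n (a : 'I_n -> nat) (x : Rn R n) : R[i] :=
  (\prod_(i < n) hermite_fun1 (a i) (tnth x i))%:C.

End hermite.

Section operators.
Context {R : realType} {n : nat}.

Definition orthogonal_group : set 'M[R]_n := [set g | g^T *m g = 1%:M].

Definition mx_act (g : 'M[R]_n) (x : Rn R n) : Rn R n :=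
  [tuple \sum_(j < n) g i j * tnth x j | i < n].

Definition T_ (g : 'M[R]_n) (f : Rn R n -> R[i]) : Rn R n -> R[i] :=
  fun x => f (mx_act g x).

(* [Pi_ m] is the projection of index n + 2m. Every component of a multi-index
   of length m is at most m, so that the sum ranges over all of them. *)
Definition Pi_ (m : nat) (f : Rn R n -> R[i]) : Rn R n -> R[i] := fun x =>
  \sum_(a : {ffun 'I_n -> 'I_m.+1} | (\sum_(i < n) a i == m)%N)
    let h := hermite_fun (fun i => a i) in inner f h * h x.

End operators.

(* Main.v *)
(* The projection is an integral operator with kernel
   K(x, y) = \sum_(|a| = m) h_a(x) h_a(y), so it is enough that K and Lebesgue
   measure are invariant under g.
   For K: the series E(w) = \sum_k H_k(s) H_k(t) / k! w^k satisfies the linear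
   equation (1 - 4 w^2)^2 E' = B E, where the polynomial B is affine in (s t,
   s^2 + t^2) (this is the differentiated Mehler formula). A product of such
   series solves the equation with the sum of the Bs, and its coefficients are
   determined by B; hence K(x, y) depends only on x . y and |x|^2 + |y|^2.
   For Lebesgue measure mu: it is translation invariant, and two applications
   of Tonelli's theorem to 1_A(g x) 1_B(y - g x) give
   mu(g^-1 A) mu(B) = mu(A) mu(B) for the unit ball B, which is even and
   invariant under g. *)
Require Import Defs.
From HB Require Import structures.
From mathcomp Require Import all_boot all_order all_algebra.
From mathcomp Require Import complex.
From mathcomp Require Import ring lra zify.
From mathcomp Require Import all_classical all_reals all_analysis.
From mathcomp Require Import measurable_realfun.

Set Implicit Arguments.
Unset Strict Implicit.
Unset Printing Implicit Defensive.

Import Order.TTheory GRing.Theory Num.Theory.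
Import numFieldNormedType.Exports.

Local Open Scope classical_set_scope.
Local Open Scope ring_scope.

(** * Mehler kernel of the Hermite polynomials *)

Section mehler.
Context {R : realType}.
Implicit Types x y p q c : R.

(** Induction on [k]: the recurrence that defines H_(k+2) is differentiated, and the H_k' that comes
    out of H_(k+1)'' is eliminated by the recurrence for H_(k+1). It makes the defining recurrence a
    three-term one. *)
Lemma hermite_poly_deriv (k : nat) :
  (hermite_poly k.+1)^`() = (2 * k.+1%:R) *: hermite_poly k :> {poly R}.
Proof.
elim: k => [|k IH].
  by rewrite /= derivC subr0 !mulr1 derivZ derivX.
rewrite [hermite_poly k.+2]/= derivB derivM derivZ derivX.
rewrite -/(hermite_poly k.+1) IH !derivZ -scalerAl.
have -> : (hermite_poly k)^`() = 2 *: 'X * hermite_poly k - hermite_poly k.+1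
  :> {poly R} by rewrite /= opprB addrC subrK.
rewrite -!mul_polyC !polyCM !rmorph_nat -[k.+2%:R]natr1; ring.
Qed.

Lemma hermite_poly_rec (k : nat) x :
  (hermite_poly k.+2).[x] = 2 * x * (hermite_poly k.+1).[x]
    - 2 * k.+1%:R * (hermite_poly k).[x].
Proof.
rewrite [hermite_poly k.+2]/= -/(hermite_poly k.+1) hermite_poly_deriv.
by rewrite !hornerE.
Qed.

Definition mehler_coef (k : nat) x y : R :=
  (hermite_poly k).[x] * (hermite_poly k).[y] / k`!%:R.

(** This is the coefficient of w^(k+3) in the differential equation. The three-term recurrence
    reduces all Hermite values to those of degree k and k+1, which are then free variables of a
    rational identity. *)
Lemma mehler_coef_rec (k : nat) x y (p := x * y) (q := x ^+ 2 + y ^+ 2) :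
  k.+4%:R * mehler_coef k.+4 x y =
  4 * p * mehler_coef k.+3 x y
  + (8 * k.+2%:R + 4 - 8 * q) * mehler_coef k.+2 x y
  + 16 * p * mehler_coef k.+1 x y
  - 16 * k.+1%:R * mehler_coef k x y.
Proof.
rewrite /mehler_coef !factS !natrM !hermite_poly_rec -!natr1 /p /q.
have [] : (k%:R + 1 != 0 :> R) /\ (k%:R + 1 + 1 != 0 :> R) by rewrite !natr1.
have [] : (k%:R + 1 + 1 + 1 != 0 :> R) /\ (k%:R + 1 + 1 + 1 + 1!= 0 :> R).
  by rewrite !natr1.
have : k`!%:R != 0 :> R by rewrite pnatr_eq0 -lt0n fact_gt0.
move: (hermite_poly k.+1).[x] (hermite_poly k.+1).[y] => u v.
move: (hermite_poly k).[x] (hermite_poly k).[y] (k`!%:R : R) (k%:R : R).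
move=> s t w d w0 *; field; do ?[apply/andP; split] => //.
Qed.

Definition mehler_lhs : {poly R} := 1 - 8%:P * 'X^2 + 16%:P * 'X^4.

(** By Mehler's formula the generating series in [c] variables is (1 - 4 w^2)^(-c/2) exp((4 p w - 4
    q w^2) / (1 - 4 w^2)); this is its logarithmic derivative times (1 - 4 w^2)^2. It is jointly
    linear in [p], [q] and [c]. *)
Definition mehler_rhs p q c : {poly R} :=
  (4 * p)%:P + (4 * c - 8 * q)%:P * 'X + (16 * p)%:P * 'X^2
  - (16 * c)%:P * 'X^3.

(* The differential equation for truncated series, hence modulo X^m. *)
Definition mehler_ode m p q c (E : {poly R}) :=
  'X^m %| mehler_lhs * E^`() - mehler_rhs p q c * E.

Lemma dvdXnP m (E : {poly R}) :
  reflect (forall k, (k < m)%N -> E`_k = 0) ('X^m %| E).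
Proof.
apply: (iffP idP) => [/dvdpP[F ->] k km|E0]; first by rewrite coefMXn km.
rewrite -(poly_take_drop m E) [take_poly m E](_ : _ = 0) ?add0r ?dvdp_mull//.
by apply/polyP => i; rewrite coef_take_poly coef0; case: ifP => // /E0.
Qed.

(** Below X^m the equation involves the coefficients of the series up to index m only, so truncation
    after X^m loses nothing. *)
Lemma mehler_ode1 m x y :
  mehler_ode m (x * y) (x ^+ 2 + y ^+ 2) 1
    (\poly_(k < m.+1) mehler_coef k x y).
Proof.
apply/dvdXnP => k km.
rewrite /mehler_lhs /mehler_rhs !(@mulrDl {poly R}) !mulNr -!mulrA !mul1r.
rewrite !(coefB, coefD, coefN, coefCM, coefXM) !coef_deriv !coef_poly.
have H0 z : (hermite_poly 0).[z] = 1 :> R by rewrite hornerC.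
have H1 z : (hermite_poly 1).[z] = 2 * z.
  by rewrite /= derivC subr0 mulr1 hornerZ hornerX.
have small j : (mehler_coef j x y *+ j = j%:R * mehler_coef j x y).
  by rewrite mulr_natl.
have lt_m j : (j <= k)%N -> (j < m)%N by move=> jk; exact: leq_ltn_trans km.
(* [mehler_coef_rec] gives the coefficients of X^3 and beyond; those of 1, X and X^2, for which it
   would need negative indices, are computed from H_0 and H_1. *)
case: k km lt_m => [|[|[|[|k]]]] km lt_m /=; rewrite ?ltnS !lt_m// ?small.
- by rewrite /mehler_coef !H1 !H0 !(factS, fact0, natrM); field.
- rewrite /mehler_coef !hermite_poly_rec !H1 !H0 !(factS, fact0, natrM).
  by field.
- rewrite /mehler_coef !hermite_poly_rec !H1 !H0 !(factS, fact0, natrM).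
  by field.
- rewrite mehler_coef_rec; ring.
- rewrite mehler_coef_rec; ring.
all: lia.
Qed.

(** Logarithmic derivatives add: by the Leibniz rule and the additivity of [mehler_rhs], the defect
    of the product is the defect of [E] times [F] plus the defect of [F] times [E]. *)
Lemma mehler_ode_mul m p q c p' q' c' (E F : {poly R}) :
  mehler_ode m p q c E -> mehler_ode m p' q' c' F ->
  mehler_ode m (p + p') (q + q') (c + c') (E * F).
Proof.
rewrite /mehler_ode => EP FP.
have -> : mehler_rhs (p + p') (q + q') (c + c') =
    mehler_rhs p q c + mehler_rhs p' q' c'.
  by rewrite /mehler_rhs !mulrDr opprD !polyCD polyCN; ring.
rewrite derivM (_ : _ - _ = (mehler_lhs * E^`() - mehler_rhs p q c * E) * F
  + (mehler_lhs * F^`() - mehler_rhs p' q' c' * F) * E); last by ring.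
by rewrite dvdp_add// dvdp_mulr.
Qed.

Lemma mehler_ode_prod m n (p q : 'I_n -> R) (E : 'I_n -> {poly R}) :
  (forall i, mehler_ode m (p i) (q i) 1 (E i)) ->
  mehler_ode m (\sum_i p i) (\sum_i q i) n%:R (\prod_i E i).
Proof.
elim: n p q E => [|n IH] p q E EP.
  rewrite !big_ord0 /mehler_ode derivC /mehler_rhs.
  by rewrite !(mulr0, subrr, mul0r, polyC0, addr0) dvdp0.
by rewrite !big_ord_recr/= -natr1; apply: mehler_ode_mul => //; exact: IH.
Qed.

(** The difference solves the same linear equation with constant term 0. As [mehler_lhs] has
    constant term 1, the coefficient of X^k expresses (k+1) times the coefficient of index k+1 by
    earlier ones. Index m is still reached, because the derivative shifts indices by one. *)
Lemma mehler_ode_unique m p q c (E F : {poly R}) :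
  mehler_ode m p q c E -> mehler_ode m p q c F -> E`_0 = F`_0 ->
  forall k, (k <= m)%N -> E`_k = F`_k.
Proof.
move=> EP FP EF0.
have /dvdXnP GP : mehler_ode m p q c (E - F).
  rewrite /mehler_ode (_ : _ - _ =
    (mehler_lhs * E^`() - mehler_rhs p q c * E)
    - (mehler_lhs * F^`() - mehler_rhs p q c * F)); last first.
    by rewrite derivB; ring.
  exact: dvdp_sub.
suff G0 k : (k <= m)%N -> (E - F)`_k = 0.
  by move=> k /G0; rewrite coefB => /eqP; rewrite subr_eq0 => /eqP.
elim/ltn_ind: k => -[|k] IH km; first by rewrite coefB EF0 subrr.
have := GP k km; move: (E - F) IH => G IH.
have {}IH j : (j <= k)%N -> G`_j = 0 by move=> jk; apply: IH; lia.
(* All terms but the first in the convolution with the derivative contain coefficients of [G] of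
   index at most k, which vanish. *)
rewrite coefB !coefM big_ord_recl subn0 big1 ?addr0; last first.
  move=> i _; rewrite coef_deriv IH ?mul0rn ?mulr0//= /bump /=.
  by have := ltn_ord i; lia.
rewrite big1 ?subr0; last by move=> i _; rewrite IH ?mulr0// leq_subr.
rewrite coef_deriv /mehler_lhs !coefD !coefN !coefCM !coefXn coef1 /=.
rewrite !mulr0 subr0 addr0 mul1r -mulr_natr => /eqP.
by rewrite mulf_eq0 pnatr_eq0 orbF => /eqP.
Qed.

(** Distributing the product over the sums gives one monomial for each family [a], with exponent the
    sum of [a]. *)
Lemma mehler_coef_sumE n m (x y : 'I_n -> R) :
  \sum_(a : {ffun 'I_n -> 'I_m.+1} | (\sum_(i < n) a i == m)%N)
    \prod_i mehler_coef (a i) (x i) (y i) =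
  (\prod_i \poly_(k < m.+1) mehler_coef k (x i) (y i))`_m.
Proof.
under [in RHS]eq_bigr do rewrite poly_def.
rewrite bigA_distr_bigA /= coef_sum big_mkcond /=; apply: eq_bigr => a _.
rewrite [in RHS]scaler_prod prodrXr coefZ coefXn eq_sym.
by case: eqP; rewrite ?mulr1 ?mulr0.
Qed.

(** The two hypotheses make both products of series solve the same equation; both have constant term
    1 because H_0 = 1. Uniqueness is used at index m, the last one that it covers. *)
Lemma mehler_coef_sum_eq n m (x y x' y' : 'I_n -> R) :
  \sum_i x i * y i = \sum_i x' i * y' i ->
  \sum_i (x i ^+ 2 + y i ^+ 2) = \sum_i (x' i ^+ 2 + y' i ^+ 2) ->
  \sum_(a : {ffun 'I_n -> 'I_m.+1} | (\sum_(i < n) a i == m)%N)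
    \prod_i mehler_coef (a i) (x i) (y i) =
  \sum_(a : {ffun 'I_n -> 'I_m.+1} | (\sum_(i < n) a i == m)%N)
    \prod_i mehler_coef (a i) (x' i) (y' i).
Proof.
move=> eqp eqq; rewrite !mehler_coef_sumE.
pose E (z w : 'I_n -> R) := \prod_i \poly_(k < m.+1) mehler_coef k (z i) (w i).
have EP z w := mehler_ode_prod (fun i => mehler_ode1 m (z i) (w i)).
have E0 z w : (E z w)`_0 = 1.
  rewrite -horner_coef0 horner_prod big1// => i _.
  by rewrite horner_coef0 coef_poly /= /mehler_coef !hornerC fact0 invr1 !mulr1.
have EP' := EP n x' y'; rewrite -eqp -eqq in EP'.
by apply: (mehler_ode_unique (EP n x y) EP') => //; rewrite !E0.
Qed.

End mehler.

(** * Translation invariance of Lebesgue measure *)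

Section measure_preserving.
Context d (T : measurableType d) {R : realType}.
Local Open Scope ereal_scope.
Variables (mu : {measure set T -> \bar R}) (phi : T -> T).
Hypothesis mphi : measurable_fun setT phi.
Hypothesis muphi : forall A, measurable A -> mu (phi @^-1` A) = mu A.

Lemma ge0_integral_preserving (f : T -> \bar R) :
  measurable_fun setT f -> (forall x, 0 <= f x) ->
  \int[mu]_x f (phi x) = \int[mu]_x f x.
Proof.
move=> mf f0.
have := @ge0_integral_pushforward _ _ _ _ _ phi mphi mu setT f measurableT mf.
rewrite preimage_setT => <- //.
by apply: eq_measure_integral => A mA _; exact: muphi.
Qed.

Lemma integrable_preserving (f : T -> \bar R) :
  mu.-integrable setT f -> mu.-integrable setT (f \o phi).
Proof.
move=> /integrableP[mf foo]; apply/integrableP; split.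
  exact: measurableT_comp.
rewrite (ge0_integral_preserving (f := abse \o f))//.
  exact: measurableT_comp.
by move=> x; exact: abse_ge0.
Qed.

Lemma integral_preserving (f : T -> \bar R) :
  mu.-integrable setT f -> \int[mu]_x f (phi x) = \int[mu]_x f x.
Proof.
move=> intf; have intphi := integrable_preserving intf.
have := @integral_pushforward _ _ _ _ _ phi mphi mu setT f.
rewrite preimage_setT => <- //; last exact: measurable_int intf.
by apply: eq_measure_integral => A mA _; exact: muphi.
Qed.

End measure_preserving.

Section translation.
Context {R : realType}.
Local Open Scope ereal_scope.

Definition tuple_add n (c x : Rn R n) : Rn R n :=
  [tuple tnth x i + tnth c i | i < n]%R.

Lemma tuple_add_cons n (c : Rn R n.+1) (p : measurableTypeR R * Rn R n) :
  tuple_add c (tuple_cons p) =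
  tuple_cons ((p.1 + thead c)%R, tuple_add [tuple of behead c] p.2).
Proof.
apply: eq_from_tnth => i; rewrite tnth_mktuple {1}(tuple_eta c).
case: (unliftP ord0 i) => [j|] ->; rewrite /tuple_cons.
  by rewrite !tnthS tnth_mktuple.
by rewrite !tnth0.
Qed.

(** Lebesgue measure is determined by its values on half-open intervals, and a translate of such an
    interval has the same length. *)
Lemma lebesgue_measure_translation (c : R) (A : set (measurableTypeR R)) :
  measurable A ->
  pushforward lebesgue_measure
    (fun x : measurableTypeR R => x + c : measurableTypeR R)%R A =
  lebesgue_measure A.
Proof.
have mc : measurable_fun [set: measurableTypeR R]
    (fun x : measurableTypeR R => x + c : measurableTypeR R)%R.
  exact: measurable_funD.
pose H := isMeasurableFun.Build _ _ _ _ _ mc.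
pose phi : {mfun measurableTypeR R >-> measurableTypeR R} := HB.pack
 (fun x : measurableTypeR R => x + c : measurableTypeR R)%R H.
move=> mA; apply/esym.
apply: (@lebesgue_measure_unique R (pushforward lebesgue_measure phi)) => //.
move=> _ [[a b]] _ <-.
have pre : (fun x => x + c)%R @^-1` `]a, b] = `](a - c)%R, (b - c)%R]%classic.
  by apply/seteqP; split => x /=; rewrite !in_itv/= ltrBlDr lerBrDr.
rewrite -[RHS]/(lebesgue_measure (_ @^-1` `]a, b])) pre.
rewrite !lebesgue_measure_itv/= !lte_fin ltrD2r.
by rewrite opprB -!EFinD addrA subrK.
Qed.

Lemma measurable_tuple_map d (T : measurableType d) n (f : 'I_n -> T -> R) :
  (forall i, measurable_fun setT (f i)) ->
  measurable_fun setT (fun x => [tuple f i x | i < n] : Rn R n).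
Proof.
move=> mf; apply/measurable_fun_tnthP => i.
by apply: (eq_measurable_fun (f i)) => // x _ /=; rewrite tnth_mktuple.
Qed.

Lemma measurable_tuple_add n (c : Rn R n) : measurable_fun setT (tuple_add c).
Proof.
apply: measurable_tuple_map => i; apply: measurable_funD => //.
exact: measurable_tnth.
Qed.

(** Induction on the dimension: a measure is the integral of the measures of the sections at a fixed
    first coordinate. The induction hypothesis removes the translation within each section, and the
    one-dimensional case removes that of the first coordinate. *)
Lemma lebesgue_measure_n_translation n (c : Rn R n) (A : set (Rn R n)) :
  measurable A ->
  lebesgue_measure_n n (tuple_add c @^-1` A) = lebesgue_measure_n n A.
Proof.
elim: n c A => [|n IH] c A mA.
  congr (_ _); apply/seteqP.
  by split=> x /=; rewrite (tuple0 (tuple_add c x)) (tuple0 x).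
rewrite /= /lebesgue_cons /pushforward /product_measure1 /=.
have mB : measurable (@tuple_cons R n @^-1` A).
  by rewrite -[X in measurable X]setTI; apply: measurable_tuple_cons.
set B := _ @^-1` A in mB *.
pose G (x : measurableTypeR R) := lebesgue_measure_n n (xsection B x).
transitivity (\int[lebesgue_measure]_x G (x + thead c)%R).
  apply: eq_integral => x _ /=.
  rewrite /G -[RHS](IH [tuple of behead c]); last first.
    exact: measurable_xsection.
  congr (_ _); rewrite !xsectionE; apply/funext => y /=.
  by rewrite /B /= (tuple_add_cons c (x, y)).
have mG : measurable_fun setT G by exact: measurable_fun_xsection.
apply: (@ge0_integral_preserving _ _ R lebesgue_measure
  (fun x => x + thead c)%R _ _ G) => //.
  exact: measurable_funD.
exact: lebesgue_measure_translation.
Qed.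

End translation.

(** * Orthogonal invariance of Lebesgue measure *)

Section orthogonal_invariance.
Context {R : realType} {n : nat}.
Local Notation mu := (@lebesgue_measure_n R n).
Implicit Types (x y : Rn R n) (g : 'M[R]_n).

Definition sqnorm x : R := \sum_i tnth x i ^+ 2.

Definition unit_ball : set (Rn R n) := [set x | sqnorm x <= 1].

Lemma measurable_tnthT i : measurable_fun setT (fun x : Rn R n => tnth x i : R).
Proof. exact: measurable_tnth. Qed.

Lemma measurable_unit_ball : measurable unit_ball.
Proof.
have m : measurable_fun setT sqnorm.
  apply: measurable_sum => i; apply: measurable_funX; exact: measurable_tnthT.
rewrite -[unit_ball]setTI (_ : unit_ball = sqnorm @^-1` `]-oo, 1]).
  by apply: m.
by apply/seteqP; split => x; rewrite /unit_ball/= in_itv.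
Qed.

Lemma measurable_cube (r : R) :
  measurable [set x : Rn R n | forall i, `|tnth x i| <= r].
Proof.
rewrite (_ : mkset _ = \bigcap_(i in [set: 'I_n])
    ((fun x : Rn R n => `|tnth x i|) @^-1` `]-oo, r])); last first.
  apply/seteqP; split => [x h i _|x h i]/=; first by rewrite in_itv/=; exact: h.
  by have := h i I; rewrite /= in_itv.
apply: fin_bigcap_measurable => // i _; rewrite -[X in measurable X]setTI.
have m : measurable_fun setT (fun x : Rn R n => `|tnth x i : R|).
  by apply: measurableT_comp => //; exact: measurable_tnthT.
by apply: m.
Qed.

Lemma lebesgue_measure_n_cube (r : R) : 0 <= r ->
  mu [set x | forall i, `|tnth x i| <= r] = ((2 * r) ^+ n)%:E.
Proof.
move=> r0; rewrite (_ : mkset _ =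
    [set x | forall i : 'I_n, `[- r, r]%classic (tnth x i)]); last first.
  by apply/seteqP; split => x /= h i; have := h i; rewrite in_itv/= ler_norml.
rewrite (@lebesgue_measure_n_box _ _ (fun=> `[- r, r]%classic))//.
under eq_bigr do rewrite lebesgue_measure_itv/= -EFinD.
have -> : (if (- r%:E < r%:E)%E then (r - - r)%:E else 0%E) = (2 * r)%:E.
  rewrite -EFinN lte_fin; case: ltP => [_|rr]; first by congr EFin; ring.
  (* The interval is degenerate here: r = 0, and both sides vanish. *)
  by congr EFin; lra.
by rewrite prodEFin prodr_const card_ord.
Qed.

Lemma unit_ball_fin : (mu unit_ball < +oo)%E.
Proof.
have mc := measurable_cube 1.
apply: (@le_lt_trans _ _ (mu [set x | forall i, `|tnth x i| <= 1])).
  apply: le_measure; rewrite ?inE//; first exact: measurable_unit_ball.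
  move=> x xB i; rewrite -(@expr_le1 _ 2)// real_normK ?num_real//.
  apply: le_trans xB; rewrite /sqnorm (bigD1 i)//= lerDl sumr_ge0// => j _.
  exact: sqr_ge0.
by rewrite lebesgue_measure_n_cube// ltry.
Qed.

Lemma unit_ball_gt0 : (0 < mu unit_ball)%E.
Proof.
(* Since r <= 1, a point of the cube of half-side r has squared norm at most n r <= 1; taking n+1
   instead of n keeps r positive when n = 0. *)
pose r : R := n.+1%:R^-1.
have r0 : 0 < r by rewrite invr_gt0.
have mc := measurable_cube r.
apply: (@lt_le_trans _ _ (mu [set x | forall i, `|tnth x i| <= r])).
  by rewrite lebesgue_measure_n_cube ?ltW// lte_fin exprn_gt0// mulr_gt0.
apply: le_measure; rewrite ?inE//; first exact: measurable_unit_ball.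
move=> x /= xr; rewrite /unit_ball /sqnorm /=.
apply: (@le_trans _ _ (\sum_(i < n) r)).
  apply: ler_sum => i _; rewrite -real_normK ?num_real// expr2.
  have := xr i; have : r <= 1 by rewrite invf_le1// ler1n.
  by have := normr_ge0 (tnth x i); nra.
by rewrite sumr_const card_ord -mulr_natl ler_pdivrMr// mul1r ler_nat.
Qed.

Definition dot x y : R := \sum_i tnth x i * tnth y i.

Let col x : 'cV[R]_n := \col_i tnth x i.

Let col_mx_act g x : col (mx_act g x) = g *m col x.
Proof.
apply/colP => i; rewrite !mxE tnth_mktuple.
by apply: eq_bigr => j _; rewrite mxE.
Qed.

Let dotE x y : dot x y = ((col x)^T *m col y) 0 0.
Proof. by rewrite mxE; apply: eq_bigr => i _; rewrite !mxE. Qed.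

Lemma dot_orthogonal g x y : orthogonal_group g ->
  dot (mx_act g x) (mx_act g y) = dot x y.
Proof.
by move=> og; rewrite !dotE !col_mx_act trmx_mul -mulmxA (mulmxA g^T) og mul1mx.
Qed.

Lemma sqnorm_orthogonal g x : orthogonal_group g ->
  sqnorm (mx_act g x) = sqnorm x.
Proof. exact: dot_orthogonal. Qed.

Lemma mx_actD g x y :
  mx_act g (tuple_add x y) = tuple_add (mx_act g x) (mx_act g y).
Proof.
apply: eq_from_tnth => i; rewrite !tnth_mktuple -big_split /=.
by apply: eq_bigr => j _; rewrite tnth_mktuple mulrDr.
Qed.

(** For square matrices g^T g = 1 implies g g^T = 1, the identity needed here. *)
Lemma mx_actK g : orthogonal_group g -> cancel (mx_act g^T) (mx_act g).
Proof.
move=> og x; apply: eq_from_tnth => i.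
have /colP/(_ i) : col (mx_act g (mx_act g^T x)) = col x.
  by rewrite !col_mx_act mulmxA (mulmx1C og) mul1mx.
by rewrite !mxE.
Qed.

Lemma measurable_mx_act g : measurable_fun setT (mx_act g).
Proof.
apply: measurable_tuple_map => i; apply: measurable_sum => j.
by apply: measurable_funM => //; exact: measurable_tnthT.
Qed.

Lemma tuple_addC x y : tuple_add x y = tuple_add y x.
Proof. by apply: eq_from_tnth => i; rewrite !tnth_mktuple addrC. Qed.

Definition tuple_opp x : Rn R n := [tuple - tnth x i | i < n].

Lemma measurable_tuple_opp : measurable_fun setT tuple_opp.
Proof.
apply: measurable_tuple_map => i; apply: measurableT_comp => //.
exact: measurable_tnthT.
Qed.

Lemma measurable_tuple_add2 : measurable_fun setT
  (fun p : Rn R n * Rn R n => tuple_add p.1 p.2).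
Proof.
apply: measurable_tuple_map => i; apply: measurable_funD.
  exact: (measurableT_comp (measurable_tnthT i)).
exact: (measurableT_comp (measurable_tnthT i)).
Qed.

Lemma unit_ball_opp_orthogonal g x : orthogonal_group g ->
  unit_ball (tuple_opp (mx_act g x)) = unit_ball x.
Proof.
move=> og; rewrite /unit_ball /= -(sqnorm_orthogonal x og).
congr (is_true (_ <= _)).
by apply: eq_bigr => i _; rewrite tnth_mktuple sqrrN.
Qed.

Lemma lebesgue_measure_n_orthogonal g (A : set (Rn R n)) :
  orthogonal_group g -> measurable A -> mu (mx_act g @^-1` A) = mu A.
Proof.
move=> og mA; pose B := unit_ball.
have mB : measurable B := measurable_unit_ball.
have mg := measurable_mx_act g.
have madd (c : Rn R n) := measurable_tuple_add c.
pose a x : \bar R := (\1_A x)%:E; pose b x : \bar R := (\1_B x)%:E.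
have ma : measurable_fun setT a.
  by apply/measurable_EFinP; exact: measurable_indic.
have mb : measurable_fun setT b.
  by apply/measurable_EFinP; exact: measurable_indic.
have a0 x : (0 <= a x)%E by rewrite lee_fin.
have b0 x : (0 <= b x)%E by rewrite lee_fin.
have Ia : (\int[mu]_x a x = mu A)%E by rewrite integral_indic// setIT.
have Ib : (\int[mu]_x b x = mu B)%E by rewrite integral_indic// setIT.
have Iag : (\int[mu]_x a (mx_act g x) = mu (mx_act g @^-1` A))%E.
  rewrite -[in RHS](setIT (_ @^-1` _)) -integral_indic//.
  by rewrite -[X in measurable X]setTI; exact: mg.
pose sub x y := tuple_add y (tuple_opp x).
have mg1 : measurable_fun setT (fun p : Rn R n * Rn R n => mx_act g p.1).
  exact: measurableT_comp mg measurable_fst.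
have mopp := measurable_tuple_opp.
have msub : measurable_fun setT
    (fun p : Rn R n * Rn R n => sub (mx_act g p.1) p.2).
  have mpair : measurable_fun setT
      (fun p : Rn R n * Rn R n => (p.2, tuple_opp (mx_act g p.1))).
    by apply: measurable_fun_pair => //; exact: (measurableT_comp mopp mg1).
  exact: (measurableT_comp measurable_tuple_add2 mpair).
have madd2 : measurable_fun setT
    (fun p : Rn R n * Rn R n => tuple_add (mx_act g p.1) p.2).
  have mpair : measurable_fun setT
      (fun p : Rn R n * Rn R n => (mx_act g p.1, p.2)).
    exact: measurable_fun_pair.
  exact: (measurableT_comp measurable_tuple_add2 mpair).
(* [F1] is 1_A(g x) 1_B(y - g x); [F2] is what it becomes under x -> x + g^T y. *)
pose F1 (p : Rn R n * Rn R n) :=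
  (a (mx_act g p.1) * b (sub (mx_act g p.1) p.2))%E.
pose F2 (p : Rn R n * Rn R n) :=
  (a (tuple_add (mx_act g p.1) p.2) * b (tuple_opp (mx_act g p.1)))%E.
have m1 : measurable_fun setT F1.
  apply: emeasurable_funM; first exact: (measurableT_comp ma mg1).
  exact: (measurableT_comp mb msub).
have m2 : measurable_fun setT F2.
  apply: emeasurable_funM; first exact: (measurableT_comp ma madd2).
  exact: (measurableT_comp mb (measurableT_comp mopp mg1)).
have key : (mu (mx_act g @^-1` A) * mu B = mu A * mu B)%E.
  transitivity (\int[mu]_x \int[mu]_y F1 (x, y))%E.
    (* For fixed x, the integral of 1_B(y - g x) over y is mu B by translation invariance. *)
    rewrite -Iag muleC -ge0_integralZl//; last exact: (measurableT_comp ma mg).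
    apply: eq_integral => x _; rewrite /F1/= ge0_integralZl//; last first.
      exact: (measurableT_comp mb (measurable_fun_pair2 _ msub)).
    rewrite muleC; congr (_ * _)%E; rewrite -Ib; apply/esym.
    under eq_integral do rewrite /sub tuple_addC.
    apply: (ge0_integral_preserving (madd _) _ mb b0).
    by move=> ? ?; exact: lebesgue_measure_n_translation.
  rewrite (fubini_tonelli F1)//; last by move=> p; rewrite mule_ge0.
  transitivity (\int[mu]_y \int[mu]_x F2 (x, y))%E.
    apply: eq_integral => y _.
    (* Substitution x -> x + g^T y: as g g^T = 1, it turns g x into g x + y and y - g x into - g
       x. *)
    rewrite -[LHS](@ge0_integral_preserving _ _ _ mu
      (tuple_add (mx_act g^T y)) _ _ (fun x => F1 (x, y)))//.
    + apply: eq_integral => x _; rewrite /F1 /= mx_actD mx_actK// tuple_addC.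
      congr (_ * b _)%E; apply: eq_from_tnth => i.
      by rewrite !tnth_mktuple; ring.
    + by move=> ? ?; exact: lebesgue_measure_n_translation.
    + exact: measurable_fun_pair1 m1.
    + by move=> x; rewrite mule_ge0.
  rewrite -(fubini_tonelli F2)//; last by move=> p; rewrite mule_ge0.
  (* The factor 1_B(- g x) equals 1_B(x), and the integral of 1_A(g x + y) over y is mu A by
     translation invariance. *)
  transitivity (\int[mu]_x (mu A * b x))%E.
    apply: eq_integral => x _; rewrite /F2 /=.
    have -> : b (tuple_opp (mx_act g x)) = b x.
      congr EFin; rewrite !indicE; congr (_%:R); congr nat_of_bool.
      by rewrite /in_mem /=; congr asbool; exact: unit_ball_opp_orthogonal.
    rewrite -Ia muleC -(@ge0_integral_preserving _ _ _ mu
      (tuple_add (mx_act g x)) _ _ a)//; last first.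
      by move=> ? ?; exact: lebesgue_measure_n_translation.
    rewrite -ge0_integralZl//; last exact: (measurableT_comp ma (madd _)).
    by apply: eq_integral => y _; rewrite muleC tuple_addC.
  by rewrite ge0_integralZl// Ib.
(* As 0 < mu B < +oo, the factor mu B can be cancelled in the extended reals. *)
have := unit_ball_fin; have := unit_ball_gt0; rewrite -/B => B0 Boo.
have Bf : mu B \is a fin_num by rewrite ge0_fin_numE// ltW.
have fB0 : fine (mu B) != 0 by rewrite gt_eqF// fine_gt0// B0.
have cancel (z : \bar R) : (z * mu B * (fine (mu B))^-1%:E = z)%E.
  by rewrite -muleA -[mu B]fineK// -EFinM divff// mule1.
by rewrite -[LHS]cancel key cancel.
Qed.

End orthogonal_invariance.

(** * Integrability of the Hermite functions *)

Section hermite_square_integrable.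
Context {R : realType}.

(* From [`|t|^j <= 1 + t^(2j)] and [(t^2/2)^j / j! <= exp (t^2/2)]. *)
Lemma expn_le_expR (j : nat) (t : R) :
  `|t| ^+ j <= (1 + 2 ^+ j * j`!%:R) * expR (t ^+ 2 / 2).
Proof.
have e1 : 1 <= expR (t ^+ 2 / 2).
  by rewrite -[leLHS]expR0 ler_expR divr_ge0 ?sqr_ge0.
have tj : (`|t| ^+ j) ^+ 2 <= 2 ^+ j * j`!%:R * expR (t ^+ 2 / 2).
  case: j => [|j]; first by rewrite !expr0 !expr1n fact0 !mul1r.
  have := @expR_ge1Dxn R (t ^+ 2 / 2) j.
  rewrite divr_ge0 ?sqr_ge0// => /(_ isT) h.
  have f0 : 0 < j.+1`!%:R :> R by rewrite ltr0n fact_gt0.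
  rewrite -mulrA [X in _ <= _ * X]mulrC -ler_pdivrMl ?exprn_gt0//.
  rewrite -ler_pdivrMr// exprAC real_normK ?num_real//.
  rewrite [X in X / _](_ : _ = (t ^+ 2 / 2) ^+ j.+1); last first.
    by rewrite expr_div_n mulrC.
  by apply: le_trans h; rewrite lerDr.
have : `|t| ^+ j <= 1 + (`|t| ^+ j) ^+ 2.
  by have := sqr_ge0 (`|t| ^+ j - 1); have := exprn_ge0 j (normr_ge0 t); nra.
by move=> /le_trans; apply; rewrite mulrDl mul1r lerD.
Qed.

(** Such bounds are stable under sums, so monomials suffice. Applied to H_k^2, it leaves half of the
    Gaussian factor exp(- t^2) of the squared Hermite function. *)
Lemma poly_le_expR (p : {poly R}) :
  exists2 C, 0 <= C & forall t, `|p.[t]| <= C * expR (t ^+ 2 / 2).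
Proof.
rewrite -[p]coefK poly_def.
apply: (big_ind (fun q : {poly R} =>
  exists2 C, 0 <= C & forall t, `|q.[t]| <= C * expR (t ^+ 2 / 2))).
- by exists 0 => // t; rewrite horner0 normr0 mul0r.
- move=> q r [C C0 qC] [D D0 rD]; exists (C + D); first exact: addr_ge0.
  by move=> t; rewrite hornerD mulrDl (le_trans (ler_normD _ _))// lerD.
- move=> i _; exists (`|p`_i| * (1 + 2 ^+ i * i`!%:R)).
    by rewrite mulr_ge0// addr_ge0// mulr_ge0.
  move=> t; rewrite hornerZ hornerXn normrM normrX -mulrA.
  by rewrite ler_wpM2l// expn_le_expR.
Qed.

Lemma measurable_hermite_fun1 k : measurable_fun setT (@hermite_fun1 R k).
Proof.
apply: measurable_funM.
  by apply: measurable_funM => //; exact: measurable_poly.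
have m : measurable_fun setT (fun t : R => - (t ^+ 2 / 2)).
  by apply: measurable_funN; exact: measurable_funM.
exact: (measurableT_comp (@measurable_expR R) m).
Qed.

Lemma hermite_fun1_sqr_integrable k :
  (\int[lebesgue_measure]_t ((hermite_fun1 k t : R) ^+ 2)%:E < +oo)%E.
Proof.
pose c : R := (Num.sqrt (2 ^+ k * k`!%:R * Num.sqrt pi))^-1.
have [C C0 HC] := poly_le_expR (hermite_poly k ^+ 2).
have /integrableP[_] : lebesgue_measure.-integrable setT
    (fun t : measurableTypeR R => ((hermite_fun1 k t : R) ^+ 2)%:E).
  (* The dominating function is a multiple of the standard normal density; dividing by
     [normal_peak 1] cancels its normalization. *)
  apply: (@le_integrable _ _ _ _ _ measurableT _
    (fun t : measurableTypeR R =>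
      (c ^+ 2 * C / normal_peak 1)%:E * (normal_pdf 0 1 t)%:E)%E).
  - apply/measurable_EFinP; apply: measurable_funX.
    exact: measurable_hermite_fun1.
  - move=> t _; rewrite -EFinM /= lee_fin.
    rewrite normal_pdfE ?oner_eq0// /normal_fun subr0 expr1n.
    have N0 : normal_peak (1 : R) != 0.
      by rewrite gt_eqF// normal_peak_gt0 ?oner_eq0.
    rewrite mulrA divfK// mulNr.
    rewrite ger0_norm ?sqr_ge0// ger0_norm; last first.
      apply: mulr_ge0; last exact: expR_ge0.
      by apply: mulr_ge0 => //; exact: sqr_ge0.
    rewrite /hermite_fun1 -/c !exprMn -mulrA -[leRHS]mulrA ler_wpM2l ?sqr_ge0//.
    have := HC t; rewrite horner_exp ger0_norm ?sqr_ge0// => {}HC.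
    apply: le_trans (ler_wpM2r (sqr_ge0 _) HC) _.
    rewrite -mulrA [expR (- _) ^+ 2]expr2 [X in C * X]mulrA -expRD.
    by rewrite subrr expR0 mul1r.
  - by apply: integrableZl => //; exact: integrable_normal_pdf.
by under eq_integral do rewrite /= ger0_norm ?sqr_ge0//.
Qed.

(** Induction on the dimension: Tonelli's theorem splits off the first coordinate and leaves a
    product of two finite integrals. In dimension 0 the measure is a Dirac mass and the integrand is
    1. *)
Lemma prod_integral_lty n (phi : 'I_n -> R -> R) :
  (forall i, measurable_fun setT (phi i)) -> (forall i t, 0 <= phi i t) ->
  (forall i, \int[lebesgue_measure]_t (phi i t)%:E < +oo)%E ->
  (\int[lebesgue_measure_n n]_x (\prod_i phi i (tnth x i))%:E < +oo)%E.
Proof.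
elim: n phi => [|n IH] phi mphi phi0 phioo.
  under eq_integral do rewrite big_ord0.
  by rewrite integral_dirac//= diracT mul1e ltry.
have mprod k (psi : 'I_k -> R -> R) : (forall i, measurable_fun setT (psi i)) ->
    measurable_fun setT (fun x : Rn R k => \prod_i psi i (tnth x i)).
  move=> mpsi; apply: measurable_prod => i _.
  by apply: (measurableT_comp (mpsi i)); exact: measurable_tnthT.
pose phi' (i : 'I_n) := phi (lift ord0 i).
rewrite /= /lebesgue_cons.
have := @ge0_integral_pushforward _ _ _ _ R _ (@measurable_tuple_cons R n)
  (lebesgue_measure \x lebesgue_measure_n n)%E setT
  (fun x => (\prod_i phi i (tnth x i))%:E) measurableT.
rewrite preimage_setT => ->; last 2 first.
- by apply/measurable_EFinP; exact: mprod.
- by move=> x _; rewrite lee_fin prodr_ge0.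
rewrite fubini_tonelli1; last 2 first.
- apply: measurableT_comp; last exact: measurable_tuple_cons.
  by apply/measurable_EFinP; exact: mprod.
- by move=> p; rewrite lee_fin prodr_ge0.
rewrite /fubini_F.
pose I := (\int[lebesgue_measure_n n]_x (\prod_i phi' i (tnth x i))%:E)%E.
have Ioo : (I < +oo)%E.
  by apply: IH => [i|i t|i]; [exact: mphi|exact: phi0|exact: phioo].
have I0 : (0 <= I)%E.
  apply: integral_ge0 => x _; rewrite lee_fin prodr_ge0 => // i _; exact: phi0.
rewrite (eq_integral
  (fun t : measurableTypeR R => (phi ord0 t)%:E * I)%E); last first.
  move=> t _; rewrite -ge0_integralZl ?lee_fin//; last 2 first.
  - by apply/measurable_EFinP; apply: mprod => i; exact: mphi.
  - by move=> x _; rewrite lee_fin prodr_ge0 => // i _; exact: phi0.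
  apply: eq_integral => y _ /=; rewrite -EFinM big_ord_recl /tuple_cons tnth0.
  by congr (_ * _)%:E; apply: eq_bigr => i _; rewrite tnthS.
have m0 : measurable_fun setT (EFin \o phi ord0) by exact/measurable_EFinP.
rewrite ge0_integralZr//; last by move=> t _; rewrite lee_fin.
have J0 : (0 <= \int[lebesgue_measure]_t (phi ord0 t)%:E)%E.
  by apply: integral_ge0 => t _; rewrite lee_fin.
by apply: lte_mul_pinfty => //; rewrite ge0_fin_numE.
Qed.

End hermite_square_integrable.

(** * Invariance of the projections *)

Section hermite_kernel.
Context {R : realType} {n : nat}.
Local Notation mu := (@lebesgue_measure_n R n).
Implicit Types (x y : Rn R n) (g : 'M[R]_n) (phi psi : Rn R n -> R).

(** [hermite_fun] before its embedding into the complex numbers, so that real and imaginary parts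
    can be treated separately. *)
Definition real_hermite_fun (a : 'I_n -> nat) x : R :=
  \prod_(i < n) hermite_fun1 (a i) (tnth x i).

Definition hermite_kernel (m : nat) x y : R :=
  \sum_(a : {ffun 'I_n -> 'I_m.+1} | (\sum_(i < n) a i == m)%N)
    real_hermite_fun (fun i => a i) y * real_hermite_fun (fun i => a i) x.

Lemma hermite_fun1_mul k (s t : R) : hermite_fun1 k s * hermite_fun1 k t =
  (2 ^+ k)^-1 * (Num.sqrt pi)^-1 * expR (- ((s ^+ 2 + t ^+ 2) / 2)) *
  mehler_coef k s t.
Proof.
rewrite /hermite_fun1 /mehler_coef mulrDl opprD expRD.
set c := Num.sqrt (_ * _); set u := _.[s]; set v := _.[t].
have -> : c^-1 * u * expR (- (s ^+ 2 / 2)) *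
    (c^-1 * v * expR (- (t ^+ 2 / 2))) =
  (c ^+ 2)^-1 * u * v * expR (- (s ^+ 2 / 2)) * expR (- (t ^+ 2 / 2)).
  by rewrite -exprVn; ring.
rewrite sqr_sqrtr ?mulr_ge0 ?exprn_ge0 ?sqrtr_ge0// !invfM; ring.
Qed.

(** The normalizing constants depend on [a] only through the product of the 2^(a_i), which is 2^m
    for every [a] of length m, and the Gaussian factors do not depend on [a]; both leave the sum. *)
Lemma hermite_kernelE m x y : hermite_kernel m x y =
  (2 ^+ m)^-1 * (Num.sqrt pi)^-1 ^+ n *
  expR (- ((\sum_i (tnth x i ^+ 2 + tnth y i ^+ 2)) / 2)) *
  \sum_(a : {ffun 'I_n -> 'I_m.+1} | (\sum_(i < n) a i == m)%N)
    \prod_i mehler_coef (a i) (tnth x i) (tnth y i).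
Proof.
rewrite mulr_sumr; apply: eq_bigr => a /eqP am.
rewrite /real_hermite_fun mulrC -big_split /=.
under eq_bigr do rewrite hermite_fun1_mul.
rewrite !big_split /= prodr_const card_ord -expR_sum.
congr (_ * _ * expR _ * _).
  by rewrite [in RHS](esym am) -prodrXr prodfV.
by rewrite sumrN -mulr_suml big_split.
Qed.

Lemma hermite_kernel_orthogonal m g x y : orthogonal_group g ->
  hermite_kernel m (mx_act g x) (mx_act g y) = hermite_kernel m x y.
Proof.
move=> og; rewrite !hermite_kernelE.
have sq : \sum_i (tnth (mx_act g x) i ^+ 2 + tnth (mx_act g y) i ^+ 2) =
    \sum_i (tnth x i ^+ 2 + tnth y i ^+ 2).
  rewrite !big_split /=; congr (_ + _); exact: sqnorm_orthogonal.
rewrite sq; congr (_ * _); apply: mehler_coef_sum_eq => //.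
exact: dot_orthogonal.
Qed.

Lemma measurable_real_hermite_fun a : measurable_fun setT (real_hermite_fun a).
Proof.
apply: measurable_prod => i _.
exact: (measurableT_comp (@measurable_hermite_fun1 R (a i))
  (measurable_tnthT i)).
Qed.

Definition sqr_integrable phi :=
  measurable_fun setT phi /\ (\int[mu]_x (phi x ^+ 2)%:E < +oo)%E.

Lemma sqr_integrable_hermite a : sqr_integrable (real_hermite_fun a).
Proof.
split; first exact: measurable_real_hermite_fun.
under eq_integral do rewrite -prodrXl.
apply: (prod_integral_lty (phi := fun i t => hermite_fun1 (a i) t ^+ 2)).
- by move=> i; apply: measurable_funX; exact: measurable_hermite_fun1.
- by move=> i t; exact: sqr_ge0.
- by move=> i; exact: hermite_fun1_sqr_integrable.
Qed.

Lemma sqr_integrable_orthogonal g phi : orthogonal_group g ->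
  sqr_integrable phi -> sqr_integrable (phi \o mx_act g).
Proof.
move=> og [mphi phioo]; have mg := measurable_mx_act g.
split; first exact: measurableT_comp.
rewrite (@ge0_integral_preserving _ _ _ mu _ mg _ (fun x => (phi x ^+ 2)%:E))//.
- by move=> ? ?; exact: lebesgue_measure_n_orthogonal.
- by apply/measurable_EFinP; exact: measurable_funX.
- by move=> x; rewrite lee_fin sqr_ge0.
Qed.

(** The product is dominated by the sum of the squares, since ([phi] + [psi])^2 and ([phi] -
    [psi])^2 are nonnegative. *)
Lemma integrable_mul phi psi : sqr_integrable phi -> sqr_integrable psi ->
  mu.-integrable setT (fun x => (phi x * psi x)%:E).
Proof.
have int chi : sqr_integrable chi ->
    mu.-integrable setT (fun x => (chi x ^+ 2)%:E).
  move=> [mchi chioo]; apply/integrableP; split.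
    by apply/measurable_EFinP; exact: measurable_funX.
  by under eq_integral do rewrite /= ger0_norm ?sqr_ge0//.
move=> iphi ipsi; apply: (le_integrable measurableT _ _
  (integrableD measurableT (int _ iphi) (int _ ipsi))).
  by apply/measurable_EFinP; apply: measurable_funM; [case: iphi|case: ipsi].
move=> x _ /=.
rewrite lee_fin [leRHS]ger0_norm; last by rewrite addr_ge0 ?sqr_ge0.
rewrite ler_norml; apply/andP; split.
  by have := sqr_ge0 (phi x + psi x); have := sqr_ge0 (phi x - psi x); nra.
by have := sqr_ge0 (phi x - psi x); have := sqr_ge0 (phi x + psi x); nra.
Qed.

Lemma integrable_hermite_kernel phi m x : sqr_integrable phi ->
  mu.-integrable setT (fun y => (phi y * hermite_kernel m x y)%:E).
Proof.
move=> iphi; have -> : (fun y => (phi y * hermite_kernel m x y)%:E) =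
    (fun y => \sum_(a : {ffun 'I_n -> 'I_m.+1} | (\sum_(i < n) a i == m)%N)
      ((real_hermite_fun (fun i => a i) x)%:E *
       (phi y * real_hermite_fun (fun i => a i) y)%:E))%E.
  apply/funext => y; rewrite mulr_sumr -sumEFin; apply: eq_bigr => a _.
  by rewrite -EFinM; congr EFin; ring.
apply: integrable_sum => // a _; apply: integrableZl => //.
exact: integrable_mul (sqr_integrable_hermite _).
Qed.

Lemma Rintegral_hermite_kernel phi m x : sqr_integrable phi ->
  (\sum_(a : {ffun 'I_n -> 'I_m.+1} | (\sum_(i < n) a i == m)%N)
    (\int[mu]_y (phi y * real_hermite_fun (fun i => a i) y)) *
      real_hermite_fun (fun i => a i) x)%R =
  (\int[mu]_y (phi y * hermite_kernel m x y))%R.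
Proof.
move=> iphi; have int a := integrable_mul iphi (sqr_integrable_hermite a).
(* The sum moves inside [fine], where linearity of the extended real integral applies; each term is
   finite by integrability, so [fine] commutes with the sum and the products. *)
transitivity (fine
  (\sum_(a : {ffun 'I_n -> 'I_m.+1} | (\sum_(i < n) a i == m)%N)
    \int[mu]_y ((real_hermite_fun (fun i => a i) x)%:E *
       (phi y * real_hermite_fun (fun i => a i) y)%:E))%E).
  rewrite -sum_fine => [|a _]; last first.
    by apply: integrable_fin_num => //; exact: integrableZl.
  apply: eq_bigr => a _; rewrite mulrC integralZl// fineM//.
  exact: integrable_fin_num.
rewrite -integral_sum//; last by move=> a; exact: integrableZl.
congr fine; apply: eq_integral => y _ /=.
rewrite mulr_sumr -sumEFin; apply: eq_bigr => a _.
by rewrite -EFinM; congr EFin; ring.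
Qed.

(** With K the kernel, the integral of phi(g y) K(x, y) equals that of phi(g y) K(g x, g y), and the
    change of variables g y -> y gives that of phi(y) K(g x, y). *)
Lemma hermite_projection_orthogonal phi m g x : orthogonal_group g ->
  sqr_integrable phi ->
  (\sum_(a : {ffun 'I_n -> 'I_m.+1} | (\sum_(i < n) a i == m)%N)
    (\int[mu]_y (phi (mx_act g y) * real_hermite_fun (fun i => a i) y)) *
      real_hermite_fun (fun i => a i) x)%R =
  (\sum_(a : {ffun 'I_n -> 'I_m.+1} | (\sum_(i < n) a i == m)%N)
    (\int[mu]_y (phi y * real_hermite_fun (fun i => a i) y)) *
      real_hermite_fun (fun i => a i) (mx_act g x))%R.
Proof.
move=> og iphi.
rewrite (Rintegral_hermite_kernel m x (sqr_integrable_orthogonal og iphi)).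
rewrite (Rintegral_hermite_kernel m (mx_act g x) iphi).
rewrite /Rintegral; congr fine.
under eq_integral do rewrite /= -(hermite_kernel_orthogonal m _ _ og).
apply: (@integral_preserving _ _ _ mu _ (measurable_mx_act g) _
  (fun y => (phi y * hermite_kernel m (mx_act g x) y)%:E)).
  by move=> ? ?; exact: lebesgue_measure_n_orthogonal.
exact: integrable_hermite_kernel.
Qed.

End hermite_kernel.

(** * Reduction from complex-valued functions to real and imaginary parts *)

Lemma L2_sqr_integrable (R : realType) (n : nat) (f : Rn R n -> R[i]) : L2 f ->
  sqr_integrable (fun x => complex.Re (f x)) /\
  sqr_integrable (fun x => complex.Im (f x)).
Proof.
move=> [mRe mIm foo].
have mnorm : measurable_fun setT (fun x => (Normc.normc (f x) ^+ 2)%:E).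
  apply/measurable_EFinP.
  apply: (eq_measurable_fun
    (fun x => complex.Re (f x) ^+ 2 + complex.Im (f x) ^+ 2)).
    by move=> x _; case: (f x) => a b /=; rewrite sqr_sqrtr// addr_ge0 ?sqr_ge0.
  by apply: measurable_funD; exact: measurable_funX.
have le_norm (p : Rn R n -> R) : measurable_fun setT p ->
    (forall x, p x ^+ 2 <= Normc.normc (f x) ^+ 2) -> sqr_integrable p.
  move=> mp ple; split=> //; apply: le_lt_trans foo.
  apply: ge0_le_integral => //.
  - by move=> x _; rewrite lee_fin sqr_ge0.
  - by apply/measurable_EFinP; exact: measurable_funX.
  - by move=> x _; rewrite lee_fin.
split; apply: le_norm => // x; case: (f x) => a b /=.
  by rewrite sqr_sqrtr ?addr_ge0 ?sqr_ge0// lerDl sqr_ge0.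
by rewrite sqr_sqrtr ?addr_ge0 ?sqr_ge0// lerDr sqr_ge0.
Qed.

(** Hermite functions are real-valued, so conjugation does nothing and the two parts of [f] do not
    mix. *)
Lemma inner_hermite_fun (R : realType) (n : nat) (f : Rn R n -> R[i])
    (a : 'I_n -> nat) :
  inner f (hermite_fun a) = Complex
    (\int[lebesgue_measure_n n]_x (complex.Re (f x) * real_hermite_fun a x))%R
    (\int[lebesgue_measure_n n]_x (complex.Im (f x) * real_hermite_fun a x))%R.
Proof.
rewrite /inner /cintegral; congr Complex; apply: eq_Rintegral => x _.
  by rewrite /hermite_fun; case: (f x) => u v /=; rewrite oppr0 mulr0 subr0.
by rewrite /hermite_fun; case: (f x) => u v /=; rewrite oppr0 mulr0 add0r.
Qed.

Lemma Re_Pi (R : realType) (n m : nat) (f : Rn R n -> R[i]) (x : Rn R n) :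
  complex.Re (Pi_ m f x) =
  \sum_(a : {ffun 'I_n -> 'I_m.+1} | (\sum_(i < n) a i == m)%N)
    (\int[lebesgue_measure_n n]_y
      (complex.Re (f y) * real_hermite_fun (fun i => a i) y))%R *
    real_hermite_fun (fun i => a i) x.
Proof.
rewrite /Pi_ raddf_sum; apply: eq_bigr => a _; cbv zeta.
by rewrite inner_hermite_fun /hermite_fun /= mulr0 subr0.
Qed.

Lemma Im_Pi (R : realType) (n m : nat) (f : Rn R n -> R[i]) (x : Rn R n) :
  complex.Im (Pi_ m f x) =
  \sum_(a : {ffun 'I_n -> 'I_m.+1} | (\sum_(i < n) a i == m)%N)
    (\int[lebesgue_measure_n n]_y
      (complex.Im (f y) * real_hermite_fun (fun i => a i) y))%R *
    real_hermite_fun (fun i => a i) x.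
Proof.
rewrite /Pi_ raddf_sum; apply: eq_bigr => a _; cbv zeta.
by rewrite inner_hermite_fun /hermite_fun /= mulr0 add0r.
Qed.

Theorem theorem3p1 (R : realType) (n : nat) (hn : (1 <= n)%N)
    (m : nat) (g : 'M[R]_n) (hg : orthogonal_group g)
    (f : Rn R n -> R[i]) (hf : L2 f) :
  Pi_ m (T_ g f) = T_ g (Pi_ m f) %[ae lebesgue_measure_n n].
Proof.
have [hRe hIm] := L2_sqr_integrable hf.
(* The equality holds at every point, because [Pi_] is an explicit finite sum of Hermite
   functions. *)
apply: aeW => x _.
apply/eqP; rewrite eq_complex; apply/andP; split; apply/eqP.
  by rewrite /T_ !Re_Pi; exact: (hermite_projection_orthogonal m x hg hRe).
by rewrite /T_ !Im_Pi; exact: (hermite_projection_orthogonal m x hg hIm).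
Qed.
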